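(* Let $\lambda\ge0$ be given and let $A=\frac12\left(1+\frac{\pi^2}{3}\right)^{-1}$. Consider the sequence $(C_l)_{l=0}^\infty$ with either $C_0=A$ or $C_0=0$, and $$C_l=\frac{A\,(l!)^\lambda}{l^2},\qquad l\ge1 .$$ Then $$\sum_{l=0}^m C_l\,C_{m-l}\le C_m$$ holds for every $m\ge0$. *)

(* Defs.v *)
From Stdlib Require Export Factorial Reals.

(* Main.v *)
(** Since [l! (m-l)! <= m!], it suffices to bound
    [m^2 / (l^2 (m-l)^2) = (1/l + 1/(m-l))^2
     = 1/l^2 + 1/(m-l)^2 + (2/m) (1/l + 1/(m-l))].
    Over [0 < l < m] this sums to at most [2*2 + (4/m)*(m/2) = 6], while the two
    end terms contribute at most [2 A C_m].  So the convolution is at most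
    [8 A C_m], and [8 A <= 1] as soon as [PI >= 3]; the exact value of
    [sum 1/l^2] is not needed. *)

Require Import Defs.
From Stdlib Require Import Factorial Reals.
From Stdlib Require Import Lra Lia.
Open Scope R_scope.

Lemma fact_mul_le (a b : nat) : (fact a * fact b <= fact (a + b))%nat.
Proof.
induction a as [|a IH]; simpl; [lia|].
pose proof (lt_O_fact (a + b)); nia.
Qed.

Lemma Rpower_fact_mul_le (lambda : R) (a b : nat) : 0 <= lambda ->
  Rpower (INR (fact a)) lambda * Rpower (INR (fact b)) lambda
    <= Rpower (INR (fact (a + b))) lambda.
Proof.
intros Hl.
pose proof (INR_fact_lt_0 a); pose proof (INR_fact_lt_0 b).
rewrite Rpower_mult_distr by assumption.
apply Rle_Rpower_l; [assumption|split].
- now apply Rmult_lt_0_compat.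
- rewrite <- mult_INR; apply le_INR, fact_mul_le.
Qed.

(** Telescoping: [/ (x + 1) ^ 2 <= / x - / (x + 1)]. The subtracted [/ INR (S n)] is what lets the
    induction close; later only the bound 2 matters. *)
Lemma sum_inv_sqr_le (n : nat) :
  sum_f_R0 (fun i => / INR (S i) ^ 2) n <= 2 - / INR (S n).
Proof.
induction n as [|n IH]; [simpl; lra|].
rewrite tech5, (S_INR (S n)).
pose proof (lt_0_INR (S n) ltac:(lia)) as Hx.
set (x := INR (S n)) in *.
assert (/ (x + 1) ^ 2 <= / x - / (x + 1)); [|lra].
replace (/ x - / (x + 1)) with (/ (x * (x + 1))) by (field; lra).
apply Rinv_le_contravar; nra.
Qed.

(** Every term after the first is at most 1/2. This linear bound suffices because the sum gets
    multiplied by [2 / m] with [m = n + 2]. *)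
Lemma sum_inv_le (n : nat) :
  sum_f_R0 (fun i => / INR (S i)) n <= INR (S (S n)) / 2.
Proof.
induction n as [|n IH]; [simpl; lra|].
rewrite tech5, (S_INR (S (S n))).
assert (/ INR (S (S n)) <= / 2); [|lra].
apply Rinv_le_contravar; [lra|].
rewrite !S_INR; pose proof (pos_INR n); lra.
Qed.

Lemma sum_f_R0_rev (f : nat -> R) (n : nat) :
  sum_f_R0 (fun i => f (n - i)%nat) n = sum_f_R0 f n.
Proof.
induction n as [|n IH]; [reflexivity|].
rewrite decomp_sum, tech5 by lia.
rewrite Rplus_comm, <- IH; reflexivity.
Qed.

(** The sum over 0 < l < m, reindexed by [l = i + 1] and [m = n + 2], so that
    [m - l = n - i + 1]. *)
Lemma sum_inv_sqr_prod_le (n : nat) :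
  sum_f_R0 (fun i => / (INR (S i) ^ 2 * INR (S (n - i)) ^ 2)) n
    <= 6 / INR (S (S n)) ^ 2.
Proof.
pose proof (lt_0_INR (S (S n)) ltac:(lia)) as Hm.
(* [h i] collects the terms of the expansion that involve [l] alone; those in [m - l] form
   [h (n - i)]. By reversal both halves have the same sum, at most 2 + 1 = 3. *)
set (h := fun i => / INR (S i) ^ 2 + / INR (S i) * (2 / INR (S (S n)))).
assert (Hh : sum_f_R0 h n <= 3).
{ unfold h; rewrite sum_plus, <- scal_sum.
  pose proof (sum_inv_sqr_le n).
  pose proof (Rinv_0_lt_compat (INR (S n)) (lt_0_INR (S n) ltac:(lia))).
  assert (2 / INR (S (S n)) * sum_f_R0 (fun i => / INR (S i)) n <= 1); [|lra].
  replace 1 with (2 / INR (S (S n)) * (INR (S (S n)) / 2)) by (field; lra).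
  apply Rmult_le_compat_l; [|apply sum_inv_le].
  apply Rlt_le, Rdiv_lt_0_compat; lra. }
rewrite (sum_eq _ (fun i => (h i + h (n - i)%nat) * / INR (S (S n)) ^ 2)).
- rewrite <- scal_sum, sum_plus, sum_f_R0_rev.
  unfold Rdiv; rewrite (Rmult_comm 6).
  apply Rmult_le_compat_l; [|lra].
  apply Rlt_le, Rinv_0_lt_compat, pow_lt, Hm.
- intros i Hi; unfold h.
  pose proof (lt_0_INR (S i) ltac:(lia)).
  pose proof (lt_0_INR (S (n - i)) ltac:(lia)).
  replace (INR (S (S n))) with (INR (S i) + INR (S (n - i)))
    by (rewrite <- plus_INR; f_equal; lia).
  field; lra.
Qed.

Theorem lemma3 (lambda : R) (hlambda : 0 <= lambda)
  (A : R) (hA : A = 1 / 2 * / (1 + PI ^ 2 / 3))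
  (C : nat -> R) (hC0 : C 0%nat = A \/ C 0%nat = 0)
  (hC : forall l : nat, (1 <= l)%nat ->
    C l = A * Rpower (INR (fact l)) lambda / INR l ^ 2) :
  forall m : nat, sum_f_R0 (fun l : nat => C l * C (m - l)%nat) m <= C m.
Proof.
assert (HA : 0 < A <= / 8).
(* From [PI > 3] follows [1 + PI ^ 2 / 3 >= 4], hence [A <= / 8]. *)
{ pose proof PI2_3_2 as Hpi; unfold PI2 in Hpi.
  assert (4 <= 1 + PI ^ 2 / 3) by nra.
  pose proof (Rinv_0_lt_compat (1 + PI ^ 2 / 3) ltac:(lra)).
  pose proof (Rinv_le_contravar 4 (1 + PI ^ 2 / 3) ltac:(lra) ltac:(lra)).
  lra. }
assert (H0 : 0 <= C 0%nat <= A) by (destruct hC0; lra).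
assert (Hpos : forall l, (1 <= l)%nat -> 0 < C l).
{ intros l Hl; rewrite hC by assumption.
  apply Rdiv_lt_0_compat.
  - apply Rmult_lt_0_compat; [lra|apply exp_pos].
  - apply pow_lt, lt_0_INR; lia. }
(* For m = 0 and m = 1 there are no middle terms, and [0 <= C 0 <= / 8] is enough. *)
intros [|[|n]].
- simpl; nra.
- pose proof (Hpos 1%nat ltac:(lia)); simpl; nra.
(* Split off the end terms l = m and l = 0, each equal to [C 0 * C m]. *)
- rewrite tech5, decomp_sum by lia.
  rewrite Nat.sub_diag, Nat.sub_0_r; simpl Init.Nat.pred.
  pose proof (Hpos (S (S n)) ltac:(lia)) as Hm.
  set (P := Rpower (INR (fact (S (S n)))) lambda).
  assert (HP : 0 < P) by apply exp_pos.
  assert (Hmid : sum_f_R0 (fun i => C (S i) * C (S (S n) - S i)%nat) n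
                 <= 6 * A * C (S (S n))).
  { apply Rle_trans with
      (sum_f_R0 (fun i => / (INR (S i) ^ 2 * INR (S (n - i)) ^ 2) * (A ^ 2 * P)) n).
    - apply sum_Rle; intros i Hi.
      replace (S (S n) - S i)%nat with (S (n - i)) by lia.
      rewrite !hC by lia.
      pose proof (lt_0_INR (S i) ltac:(lia)).
      pose proof (lt_0_INR (S (n - i)) ltac:(lia)).
      pose proof (Rpower_fact_mul_le lambda (S i) (S (n - i)) hlambda) as HF.
      replace (S i + S (n - i))%nat with (S (S n)) in HF by lia; fold P in HF.
      set (p := Rpower (INR (fact (S i))) lambda) in *.
      set (q := Rpower (INR (fact (S (n - i)))) lambda) in *.
      replace (A * p / INR (S i) ^ 2 * (A * q / INR (S (n - i)) ^ 2))
        with (/ (INR (S i) ^ 2 * INR (S (n - i)) ^ 2) * (A ^ 2 * (p * q)))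
        by (field; lra).
      apply Rmult_le_compat_l.
      + apply Rlt_le, Rinv_0_lt_compat, Rmult_lt_0_compat; now apply pow_lt.
      + apply Rmult_le_compat_l; [apply pow2_ge_0|exact HF].
    - rewrite <- scal_sum, (hC (S (S n))) by lia; fold P.
      replace (6 * A * (A * P / INR (S (S n)) ^ 2))
        with (A ^ 2 * P * (6 / INR (S (S n)) ^ 2))
        by (field; apply not_0_INR; lia).
      apply Rmult_le_compat_l; [|apply sum_inv_sqr_prod_le].
      apply Rmult_le_pos; [apply pow2_ge_0|lra]. }
  (* The ends give at most [2 * A * C m] and the middle at most [6 * A * C m]; conclude by
     [8 * A <= 1]. *)
  nra.
Qed.
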